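(* Let $\mathcal{H}$ be a finite family of connected graphs. (i) There exists a constant $c(\mathcal{H})$ with $\mathrm{ispc}(G)\le c(\mathcal{H})$ for every connected $\mathcal{H}$-free graph $G$ if and only if $\mathcal{H}\le\{K_n,K_{1,n},F^{(1)}_n,F^{(2)}_n\}$ for some integer $n\ge4$. (ii) There exists a constant $c(\mathcal{H})$ with $\mathrm{ispp}(G)\le c(\mathcal{H})$ for every connected $\mathcal{H}$-free graph $G$ if and only if $\mathcal{H}\le\{K_n,K_{1,n},F^{(1)}_n,F^{(2)}_n,F^{(4)}_n,F^{(5)}_n\}$ for some integer $n\ge4$.
   Context: Graphs are finite and simple. $G$ is $\mathcal{H}$-free if it has no induced subgraph isomorphic to a member of $\mathcal{H}$. $\mathcal{H}_1\le\mathcal{H}_2$ means every member of $\mathcal{H}_2$ contains an induced subgraph isomorphic to some member of $\mathcal{H}_1$. A path $P$ in $G$ is isometric if it is a shortest path in $G$ between its endvertices. An isometric path cover of $G$ is a family of isometric paths of $G$ whose vertex sets cover $V(G)$; an isometric path partition is one with pairwise vertex-disjoint members. $\mathrm{ispc}(G)$, $\mathrm{ispp}(G)$ are the minimum cardinalities of an isometric path cover and partition. $K_n$: complete graph of order $n$; $K_{1,n}$: star of order $n+1$. With $A=\{x_i,y_i,z_i:1\le i\le n\}$: $F^{(1)}_n$: vertices $A\setminus\{x_i:3\le i\le n\}$, edges $x_1x_2,x_1y_1,x_1z_1$, $y_iy_{i+1},z_iz_{i+1}$ ($1\le i\le n-1$). $F^{(2)}_n$: vertices $A\setminus\{x_i:2\le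 i\le n\}$, edges $x_1y_1,x_1z_1,y_1z_1$, $y_iy_{i+1},z_iz_{i+1}$ ($1\le i\le n-1$). $F^{(4)}_n$: vertices $\{x_1,x_2\}\cup\{y_i,z_i:1\le i\le n\}$, edges $x_1y_1,x_1z_1,x_2y_1,x_2z_1$, $y_iy_{i+1},z_iz_{i+1}$ ($1\le i\le n-1$). $F^{(5)}_n$: $F^{(4)}_n$ plus the edge $x_1x_2$. *)

(* Defs.v *)
From mathcomp Require Import all_boot.
From mathcomp Require Import boolp.
From Stdlib Require List.

Set Implicit Arguments.
Unset Strict Implicit.
Unset Printing Implicit Defensive.

Record sgraph := SGraph {
  vertex :> finType;
  edge : rel vertex;
  edge_sym : symmetric edge;
  edge_irr : irreflexive edge
}.

Definition connected (G : sgraph) : Prop :=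
  0 < #|G| /\ forall x y : G, connect (@edge G) x y.

Section Induced.
Variables (G : sgraph) (S : {set G}).
Definition induced_edge : rel {x : G | x \in S} :=
  fun x y => edge (val x) (val y).
Lemma induced_sym : symmetric induced_edge.
Proof. by move=> x y; apply: edge_sym. Qed.
Lemma induced_irr : irreflexive induced_edge.
Proof. by move=> x; apply: edge_irr. Qed.
Definition induced : sgraph := SGraph induced_sym induced_irr.
End Induced.

Definition isomorphic (G H : sgraph) : Prop :=
  exists f : G -> H,
    bijective f /\ forall x y : G, edge (f x) (f y) = edge x y.

Definition contains_induced (G F : sgraph) : Prop :=
  exists S : {set G}, isomorphic (induced S) F.

Definition free (HH : seq sgraph) (G : sgraph) : Prop :=
  forall F, List.In F HH -> ~ contains_induced G F.

Definition family_le (H1 H2 : seq sgraph) : Prop :=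
  forall F2, List.In F2 H2 -> exists F1, List.In F1 H1 /\ contains_induced F2 F1.

Section IsometricPaths.
Variable G : sgraph.

(* A path is given by the sequence of its vertices; a single vertex is a path. *)
Definition path_between (x y : G) (s : seq G) : bool :=
  if s is a :: p then
    [&& a == x, last a p == y, path (@edge G) a p & uniq s]
  else false.

Definition isometric (s : seq G) : Prop :=
  exists x y : G,
    path_between x y s /\
    forall t : seq G, path_between x y t -> size s <= size t.

Definition isometric_path_cover (P : seq (seq G)) : Prop :=
  (forall s, s \in P -> isometric s) /\
  (forall v : G, exists s, s \in P /\ v \in s).

Definition isometric_path_partition (P : seq (seq G)) : Prop :=
  isometric_path_cover P /\
  pairwise (fun s t : seq G => [disjoint s & t]) P.

Lemma isometric_singletons :
  isometric_path_partition [seq [:: v] | v <- enum G].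
Proof.
split; [split|].
- move=> _ /mapP[v _ ->]; exists v, v; split; first by rewrite /= !eqxx.
  by case.
- move=> v; exists [:: v]; split; last by rewrite mem_head.
  by apply: map_f; rewrite mem_enum.
- rewrite pairwise_map.
  apply: (sub_pairwise (r := fun x y : G => x != y)).
    by move=> x y /= xy; rewrite disjoint_has /= inE orbF.
  by rewrite -uniq_pairwise enum_uniq.
Qed.

Definition has_cover_of_size (k : nat) : bool :=
  `[< exists P, isometric_path_cover P /\ size P = k >].
Definition has_partition_of_size (k : nat) : bool :=
  `[< exists P, isometric_path_partition P /\ size P = k >].

Lemma ex_ispc : exists k, has_cover_of_size k.
Proof.
exists (size [seq [:: v] | v <- enum G]); apply/asboolP.
by eexists; split; first exact: (proj1 isometric_singletons).
Qed.
Lemma ex_ispp : exists k, has_partition_of_size k.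
Proof.
exists (size [seq [:: v] | v <- enum G]); apply/asboolP.
by eexists; split; first exact: isometric_singletons.
Qed.

Definition ispc : nat := ex_minn ex_ispc.
Definition ispp : nat := ex_minn ex_ispp.

End IsometricPaths.

(* The simple graph whose edges are the pairs listed, in either order, by e. *)
Section SymClosure.
Variables (T : finType) (e : rel T).
Definition symc_edge : rel T := fun x y => (x != y) && (e x y || e y x).
Lemma symc_sym : symmetric symc_edge.
Proof. by move=> x y; rewrite /symc_edge eq_sym orbC. Qed.
Lemma symc_irr : irreflexive symc_edge.
Proof. by move=> x; rewrite /symc_edge eqxx. Qed.
Definition symc_graph : sgraph := SGraph symc_sym symc_irr.
End SymClosure.

Definition Kn (n : nat) : sgraph := @symc_graph 'I_n (fun _ _ => true).

(* K_{1,n}: None is the centre. *)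
Definition K1n (n : nat) : sgraph :=
  @symc_graph (option 'I_n) (fun u v => ~~ isSome u && isSome v).

(* vx i, vy i, vz i stand for x_{i+1}, y_{i+1}, z_{i+1}. *)
Local Notation vx i := (inl i).
Local Notation vy i := (inr (inl i)).
Local Notation vz i := (inr (inr i)).

Definition F1 (n : nat) : sgraph :=
  @symc_graph ('I_2 + ('I_n + 'I_n))%type (fun u v =>
    match u, v with
    | vx i, vx j => (i == 0 :> nat) && (j == 1 :> nat)
    | vx i, vy j => (i == 0 :> nat) && (j == 0 :> nat)
    | vx i, vz j => (i == 0 :> nat) && (j == 0 :> nat)
    | vy i, vy j => j == i.+1 :> nat
    | vz i, vz j => j == i.+1 :> nat
    | _, _ => false
    end).

Definition F2 (n : nat) : sgraph :=
  @symc_graph ('I_1 + ('I_n + 'I_n))%type (fun u v =>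
    match u, v with
    | vx i, vy j => j == 0 :> nat
    | vx i, vz j => j == 0 :> nat
    | vy i, vz j => (i == 0 :> nat) && (j == 0 :> nat)
    | vy i, vy j => j == i.+1 :> nat
    | vz i, vz j => j == i.+1 :> nat
    | _, _ => false
    end).

Definition F4 (n : nat) : sgraph :=
  @symc_graph ('I_2 + ('I_n + 'I_n))%type (fun u v =>
    match u, v with
    | vx i, vy j => j == 0 :> nat
    | vx i, vz j => j == 0 :> nat
    | vy i, vy j => j == i.+1 :> nat
    | vz i, vz j => j == i.+1 :> nat
    | _, _ => false
    end).

Definition F5 (n : nat) : sgraph :=
  @symc_graph ('I_2 + ('I_n + 'I_n))%type (fun u v =>
    match u, v with
    | vx i, vx j => (i == 0 :> nat) && (j == 1 :> nat)
    | vx i, vy j => j == 0 :> nat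
    | vx i, vz j => j == 0 :> nat
    | vy i, vy j => j == i.+1 :> nat
    | vz i, vz j => j == i.+1 :> nat
    | _, _ => false
    end).

(* Main.v *)
Require Import Defs.
From mathcomp Require Import all_boot.
From mathcomp Require Import boolp zify.

Set Implicit Arguments.
Unset Strict Implicit.
Unset Printing Implicit Defensive.

(** Sufficiency. Excluding [K_n] and [K_{1,n}] bounds the degree, by Ramsey.
    Let d be the depth of a breadth-first search from a root r; any path along
    which d increases is isometric. Let v_0 = r, v_1, ..., v_D be such a path.
    If x is off the path, adjacent to it, and of depth l with
    n < l < D - n, then excluding F1 and F2 forces x to be adjacent to both
    v_{l-1} and v_{l+1}, so x can replace v_l; excluding also F4 and F5 leaves
    no such x. Hence, for each of the boundedly many vertices a of depth n + 1,
    the descendants of a, except those in a bounded ball around a vertex near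
    the last layer, form a blow-up of a path with bounded parts, which boundedly
    many increasing paths cover (a single path, when F4 and F5 are excluded).

    Necessity. Attach many vertices to a long path, far apart, each in the way
    prescribed by F1, F2, F4 or F5. Each attachment contains an end of some
    member of any cover (for F4 and F5, of any partition), so ispc (ispp) is
    large, whereas a small connected induced subgraph meets at most one
    attachment and so embeds in the corresponding F_n. *)

(** * Induced embeddings *)

Definition embeds (F G : sgraph) : Prop :=
  exists2 f : F -> G, injective f & forall x y, edge (f x) (f y) = edge x y.

Lemma embeds_trans F G H : embeds F G -> embeds G H -> embeds F H.
Proof.
move=> [f fI fE] [g gI gE]; exists (g \o f); first exact: inj_comp.
by move=> x y /=; rewrite gE fE.
Qed.

(** Turns an embedding around by counting vertices, so that the inverses of the maps into the forks
    below need not be written out. *)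
Lemma embeds_bij F G : embeds F G -> #|G| <= #|F| -> embeds G F.
Proof.
move=> [f fI fE] /(inj_card_bij fI)[g fK gK]; exists g; first exact: can_inj gK.
by move=> x y; rewrite -fE !gK.
Qed.

Lemma contains_inducedE F G : contains_induced G F <-> embeds F G.
Proof.
split=> [[S [f [[g fK gK] fE]]] | [f fI fE]].
  exists (val \o g); first exact: inj_comp val_inj (can_inj gK).
  by move=> x y; rewrite -[in RHS](gK x) -[in RHS](gK y) fE.
exists [set y in codom f].
have inS (u : induced [set y in codom f]) : val u \in codom f.
  by case: u => /= u; rewrite inE.
have inS' x : f x \in [set y in codom f] by rewrite inE codom_f.
exists (fun u => iinv (inS u)); split=> [|x y]; last by rewrite -fE !f_iinv.
exists (fun x => exist _ (f x) (inS' x)) => [u | x].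
  by apply: val_inj; rewrite /= f_iinv.
by apply: fI; rewrite f_iinv.
Qed.

Lemma symc_edgeE (T : finType) (e : rel T) : irreflexive e ->
  forall x y, symc_edge e x y = e x y || e y x.
Proof.
by move=> eI x y; rewrite /symc_edge; have [->|] //= := eqVneq x y; rewrite eI.
Qed.

(** * Ramsey's theorem and bounded degree *)

Section Ramsey.
Variables (T : finType) (e : rel T).
Hypothesis eS : symmetric e.

Definition homogeneous (c : bool) (B : {set T}) :=
  {in B &, forall u v, u != v -> e u v = c}.

Lemma homogeneousU1 c x (B : {set T}) :
  homogeneous c B -> {in B, forall y, e x y = c} -> homogeneous c (x |: B).
Proof.
move=> hB xB u v; rewrite !inE => /predU1P[->|uB] /predU1P[->|vB].
- by rewrite eqxx.
- by move=> _; apply: xB.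
- by move=> _; rewrite eS; apply: xB.
- exact: hB.
Qed.

(** Induction on [a + b]. The neighbours and the non-neighbours of some [x] in [A] partition
    [A :\ x], so one of the two classes still meets half of the threshold. A homogeneous set found
    there either suffices or is completed by [x]. *)
Lemma ramsey a b (A : {set T}) : 2 ^ (a + b) <= #|A| ->
  (exists B : {set T}, [/\ B \subset A, #|B| = a & homogeneous true B]) \/
  (exists B : {set T}, [/\ B \subset A, #|B| = b & homogeneous false B]).
Proof.
have h0 c : homogeneous c set0 by move=> u v; rewrite inE.
have [k] := ubnP (a + b); elim: k => // k IHk in a b A *; rewrite ltnS.
case: a => [|a]; first by left; exists set0; rewrite sub0set cards0.
case: b => [|b]; first by right; exists set0; rewrite sub0set cards0.
rewrite addSn expnS => abk cA.
have /card_gt0P[x xA] : 0 < #|A| by apply: leq_trans cA; rewrite muln_gt0 expn_gt0.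
pose N c := [set y in A :\ x | e x y == c].
have NA c : N c \subset A by apply/subsetP=> y; rewrite !inE => /andP[/andP[]].
have xN c (B : {set T}) : B \subset N c -> x \notin B.
  by move=> /subsetP BN; apply/negP=> /BN; rewrite !inE eqxx.
have eN c (B : {set T}) : B \subset N c -> {in B, forall y, e x y = c}.
  by move=> /subsetP BN y /BN; rewrite !inE => /andP[_ /eqP].
have sub c (B : {set T}) : B \subset N c -> x |: B \subset A.
  by move=> BN; rewrite subUset sub1set xA (subset_trans BN (NA c)).
have cN : #|A| = (#|N true| + #|N false|).+1.
  rewrite (cardsD1 x) xA add1n; congr _.+1.
  rewrite -(cardsID [set y | e x y] (A :\ x)); congr (_ + _).
    by apply: eq_card => y; rewrite !inE eqb_id.
  by apply: eq_card => y; rewrite !inE andbC eqbF_neg.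
have := expn_gt0 2 (a + b.+1); rewrite /= => exp_gt0.
have [cT|cT] := leqP (2 ^ (a + b.+1)) #|N true|.
  have [||[B [BN cB hB]]|[B [BN cB hB]]] := IHk a b.+1 (N true) => //.
    by left; exists (x |: B); rewrite cardsU1 (xN _ _ BN) cB; split;
      [exact: sub BN | | exact: homogeneousU1 hB (eN _ _ BN)].
  by right; exists B; rewrite (subset_trans BN).
have cF : 2 ^ (a.+1 + b) <= #|N false| by rewrite addSnnS; lia.
have [||[B [BN cB hB]]|[B [BN cB hB]]] := IHk a.+1 b (N false) => //; first lia.
  by left; exists B; rewrite (subset_trans BN).
by right; exists (x |: B); rewrite cardsU1 (xN _ _ BN) cB; split;
  [exact: sub BN | | exact: homogeneousU1 hB (eN _ _ BN)].
Qed.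

End Ramsey.

(** Ramsey inside the neighbourhood of [x]: a clique of [n] neighbours is a copy of [Kn n], and an
    independent set of [n] neighbours forms [K1n n] with centre [x]. *)
Lemma degree_bound (G : sgraph) n (x : G) :
  ~ embeds (Kn n) G -> ~ embeds (K1n n) G ->
  #|[set y | edge x y]| < 2 ^ (n + n).
Proof.
move=> noK noS; rewrite ltnNge; apply/negP=> /(ramsey (@edge_sym G)).
have pick (B : {set G}) : #|B| = n ->
    exists2 f : 'I_n -> G, injective f & forall i, f i \in B.
  move=> cB; exists (fun i => enum_val (cast_ord (esym cB) i)).
    by move=> i j /enum_val_inj/cast_ord_inj.
  by move=> i; apply: enum_valP.
case=> [[B [/subsetP BN /pick[f fI fB] hB]] | [B [/subsetP BN /pick[f fI fB] hB]]].
  apply: noK; exists f => // i j; rewrite /= /symc_edge orbT andbT.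
  have [->|ij] := eqVneq i j; first exact: edge_irr.
  by rewrite hB // (inj_eq fI).
have xf i : edge x (f i) by have := BN _ (fB i); rewrite inE.
apply: noS; exists (fun o => oapp f x o).
  move=> [i|] [j|] //=; first by move/fI->.
    by move=> fx; have := xf i; rewrite fx edge_irr.
  by move=> fx; have := xf j; rewrite -fx edge_irr.
move=> [i|] [j|]; rewrite /= symc_edgeE ?xf ?[edge (f i) x]edge_sym ?xf ?edge_irr //;
  try by case.
have [->|ij] := eqVneq i j; first by rewrite edge_irr.
by rewrite hB // (inj_eq fI).
Qed.

(** * Combs and the graphs [F1], [F2], [F4], [F5] *)

Definition attached (b1 b2 b3 : bool) (p j : nat) : bool :=
  [|| b1 && (j.+1 == p), b2 && (j == p) | b3 && (j == p.+1)].

(* A path on L vertices and m further vertices; the i-th of these is adjacent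
   to those of the path vertices K*i+c-1, K*i+c, K*i+c+1 that b1, b2, b3
   select. *)
Definition comb_arc L m K c b1 b2 b3 : rel ('I_L + 'I_m)%type := fun u v =>
  match u, v with
  | inl i, inl j => j == i.+1 :> nat
  | inl j, inr i => attached b1 b2 b3 (K * i + c) j
  | _, _ => false
  end.

Definition comb L m K c b1 b2 b3 : sgraph :=
  symc_graph (@comb_arc L m K c b1 b2 b3).

Lemma comb_edge L m K c b1 b2 b3 (u v : comb L m K c b1 b2 b3) :
  edge u v = comb_arc K c b1 b2 b3 u v || comb_arc K c b1 b2 b3 v u.
Proof. by rewrite /= symc_edgeE // => -[i|i] //=; lia. Qed.

(** The tooth sits at the middle vertex [n] of a path on [2n + 1] vertices. The middle vertex plays
    the role of [x_1] and the tooth that of [x_2]; the three flags decide among [F1], [F4] and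
    [F5]. *)
Definition fork n b1 b2 b3 : sgraph := comb (n + n).+1 1 0 n b1 b2 b3.

(* F2 n has an even number of spine vertices: z_n ... z_1 y_1 ... y_n. *)
Definition fork2 n : sgraph := comb (n + n).-1.+1 1 0 n.-1 false true true.

Definition fork_vertex n b1 b2 b3 (u : 'I_2 + ('I_n + 'I_n)) : fork n b1 b2 b3 :=
  match u with
  | inl i => if i == 0 :> nat then inl (inord n) else inr ord0
  | inr (inl k) => inl (inord (n.+1 + k))
  | inr (inr k) => inl (inord (n.-1 - k))
  end.

Lemma fork_vertex_inj n b1 b2 b3 : injective (@fork_vertex n b1 b2 b3).
Proof.
move=> [[[|[|i]] iP]|[[i iP]|[i iP]]] [[[|[|j]] jP]|[[j jP]|[j jP]]] //= H;
  repeat (congr inr || congr inl); try apply: ord_inj => //=; move: H => //;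
  by move=> [] /(congr1 (@nat_of_ord _)); rewrite !inordK; lia.
Qed.

Lemma embeds_F1 n : embeds (F1 n) (fork n false true false).
Proof.
exists (@fork_vertex n _ _ _); first exact: fork_vertex_inj.
move=> x y; rewrite comb_edge /= symc_edgeE; last by case=> [i|[i|i]] /=; lia.
case: x y => [[[|[|i]] iP]|[[i iP]|[i iP]]] [[[|[|j]] jP]|[[j jP]|[j jP]]] //=;
  by rewrite /attached /= ?inordK; lia.
Qed.

Lemma embeds_F4 n : embeds (F4 n) (fork n true false true).
Proof.
exists (@fork_vertex n _ _ _); first exact: fork_vertex_inj.
move=> x y; rewrite comb_edge /= symc_edgeE; last by case=> [i|[i|i]] /=; lia.
case: x y => [[[|[|i]] iP]|[[i iP]|[i iP]]] [[[|[|j]] jP]|[[j jP]|[j jP]]] //=;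
  by rewrite /attached /= ?inordK; lia.
Qed.

Lemma embeds_F5 n : embeds (F5 n) (fork n true true true).
Proof.
exists (@fork_vertex n _ _ _); first exact: fork_vertex_inj.
move=> x y; rewrite comb_edge /= symc_edgeE; last by case=> [i|[i|i]] /=; lia.
case: x y => [[[|[|i]] iP]|[[i iP]|[i iP]]] [[[|[|j]] jP]|[[j jP]|[j jP]]] //=;
  by rewrite /attached /= ?inordK; lia.
Qed.

Definition fork2_vertex n (u : 'I_1 + ('I_n + 'I_n)) : fork2 n :=
  match u with
  | inl i => inr ord0
  | inr (inl k) => inl (inord (n + k))
  | inr (inr k) => inl (inord (n.-1 - k))
  end.

Lemma embeds_F2 n : embeds (F2 n) (fork2 n).
Proof.
exists (@fork2_vertex n).
  move=> [[[|i] iP]|[[i iP]|[i iP]]] [[[|j] jP]|[[j jP]|[j jP]]] //= H;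
    repeat (congr inr || congr inl); try apply: ord_inj => //=; move: H => //;
    by move=> [] /(congr1 (@nat_of_ord _)); rewrite !inordK; lia.
move=> x y; rewrite comb_edge /= symc_edgeE; last by case=> [i|[i|i]] /=; lia.
case: x y => [[i iP]|[[i iP]|[i iP]]] [[j jP]|[[j jP]|[j jP]]] //=;
  by rewrite /attached /= ?inordK; lia.
Qed.

Lemma fork_embeds_F1 n : embeds (fork n false true false) (F1 n).
Proof. by apply: embeds_bij (embeds_F1 n) _; rewrite !card_sum !card_ord; lia. Qed.

Lemma fork_embeds_F4 n : embeds (fork n true false true) (F4 n).
Proof. by apply: embeds_bij (embeds_F4 n) _; rewrite !card_sum !card_ord; lia. Qed.

Lemma fork_embeds_F5 n : embeds (fork n true true true) (F5 n).
Proof. by apply: embeds_bij (embeds_F5 n) _; rewrite !card_sum !card_ord; lia. Qed.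

Lemma fork2_embeds_F2 n : 0 < n -> embeds (fork2 n) (F2 n).
Proof.
by move=> ?; apply: embeds_bij (embeds_F2 n) _; rewrite !card_sum !card_ord; lia.
Qed.

(** * Breadth-first search *)

(** An axiomatic form of the distance from [r]: following parents gives a walk of length [d x] from
    [r] to [x], and by the second clause no walk is shorter. *)
Definition bfs_depth (G : sgraph) (r : G) (d : G -> nat) : Prop :=
  [/\ forall x, (d x == 0) = (x == r),
      forall x y, edge x y -> d y <= (d x).+1
    & forall x k, d x = k.+1 -> exists2 y, edge y x & d y = k].

Lemma bfs_depth_exists (G : sgraph) (r : G) :
  connected G -> exists d : G -> nat, bfs_depth r d.
Proof.
move=> [_ Gc].
(* Walks of length exactly [k], vertices possibly repeated; the depth is the least such length. *)
pose reach x k := [exists t : k.-tuple G, path (@edge G) r t && (last r t == x)].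
have reachP x k : reflect (exists t, [/\ size t = k, path (@edge G) r t & last r t = x])
                          (reach x k).
  apply: (iffP existsP) => [[t /andP[pt /eqP lt]] | [t [st pt lt]]].
    by exists t; rewrite size_tuple.
  by move/eqP: st => st; exists (Tuple st); rewrite /= pt lt eqxx.
have reach_ex x : exists k, reach x k.
  have /connectP[p pp ->] := Gc r x.
  by exists (size p); apply/reachP; exists p.
pose d x := ex_minn (reach_ex x).
have dr x : reach x (d x) by rewrite /d; case: ex_minnP.
have dle x k : reach x k -> d x <= k by rewrite /d; case: ex_minnP => m _; apply.
have lip x y : edge x y -> d y <= (d x).+1.
  move=> xy; have /reachP[t [st pt lt]] := dr x; apply: dle; apply/reachP.
  by exists (rcons t y); rewrite size_rcons st rcons_path pt lt last_rcons.
exists d; split=> // [x | x k dxk].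
  apply/eqP/eqP=> [dx0 | ->].
    by have /reachP[t [st _ <-]] := dr x; case: t st; rewrite dx0.
  by apply/eqP; rewrite -leqn0; apply: dle; apply/reachP; exists [::].
have /reachP[t [st pt lt]] := dr x; rewrite dxk in st.
case/lastP: t => [|t z] // in st pt lt *.
move: st pt lt; rewrite size_rcons rcons_path last_rcons.
move=> [st] /andP[pt ez] zx; rewrite {}zx in ez; exists (last r t) => //.
have le1 : d (last r t) <= k by apply: dle; apply/reachP; exists t.
have := lip _ _ ez; lia.
Qed.

Section Geodesics.
Variables (G : sgraph) (r : G) (d : G -> nat).
Hypothesis dP : bfs_depth r d.

Lemma depth_edge (x y : G) : edge x y -> d y <= (d x).+1 /\ d x <= (d y).+1.
Proof.
by case: dP => _ lip _ xy; split; apply: lip; rewrite // edge_sym.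
Qed.

(** [connect down a x] thus means that [x] is a descendant of [a]; a vertex may have several
    parents. *)
Definition down (x y : G) : bool := edge x y && (d y == (d x).+1).

Lemma down_path_depth x p : path down x p -> d (last x p) = d x + size p.
Proof.
elim: p x => [|y p IHp] x /=; first by rewrite addn0.
by move=> /andP[/andP[_ /eqP dy] /IHp->]; rewrite dy addSnnS.
Qed.

Lemma edge_path_depth x p : path (@edge G) x p -> d (last x p) <= d x + size p.
Proof.
elim: p x => [|y p IHp] x /=; first by rewrite addn0.
by move=> /andP[/depth_edge[dy _] /IHp H]; lia.
Qed.

(** Depth grows by at most one along any edge, so no path between the two ends has fewer edges than
    their depths differ by. Strictly increasing depths also make the vertices distinct. *)
Lemma down_path_isometric x p : path down x p -> isometric (x :: p).
Proof.
move=> xp; exists x, (last x p); split.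
  rewrite /path_between !eqxx; have -> : path (@edge G) x p.
    by apply: sub_path xp => u v /andP[].
  suff : sorted ltn (map d (x :: p)).
    by move/(sorted_uniq ltn_trans ltnn)/map_uniq.
  rewrite /= path_map; apply: sub_path xp => u v /andP[_ /eqP]; rewrite /=; lia.
move=> [|a t] //= /and4P[/eqP-> /eqP e pt _].
by have := edge_path_depth pt; rewrite e (down_path_depth xp) leq_add2l.
Qed.

Lemma connect_down_depth x y : connect down x y -> d x <= d y.
Proof.
by move=> /connectP[p /down_path_depth pp ->]; rewrite pp leq_addr.
Qed.

Lemma connect_down_eq x y : connect down x y -> d y <= d x -> x = y.
Proof.
move=> /connectP[[|z p] pp ->] //; rewrite (down_path_depth pp) /=; lia.
Qed.

Lemma connect_down_pred x y : connect down x y -> d x < d y ->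
  exists z, [/\ connect down x z, edge z y & (d z).+1 = d y].
Proof.
move=> /connectP[p]; case/lastP: p => [|p z] /=; first by move=> _ ->; rewrite ltnn.
rewrite rcons_path last_rcons => /andP[pp /andP[ez /eqP dz]] ->.
by exists (last x p); split=> //; apply/connectP; exists p.
Qed.

Lemma connect_down_ancestor x y k : connect down x y -> d x <= k <= d y ->
  exists z, [/\ connect down x z, connect down z y & d z = k].
Proof.
move=> xy /andP[xk ky]; have [m ym] := ubnP (d y - k).
elim: m => // m IHm in y xy ky ym *.
have [ky'|ky'] := eqVneq (d y) k; first by exists y; rewrite xy connect0.
have [|z [xz zy dz]] := connect_down_pred xy; first lia.
have [|//|t [xt tz dt]] := IHm z xz; try lia.
exists t; split=> //; apply: connect_trans tz (connect1 _).
by rewrite /down zy dz eqxx.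
Qed.

Lemma ancestor y k : k <= d y -> exists2 x, d x = k & connect down x y.
Proof.
case: dP => _ _ parent ky; have [m ym] := ubnP (d y - k).
elim: m => // m IHm in y ky ym *.
have [<-|ky'] := eqVneq (d y) k; first by exists y; rewrite ?connect0.
have [|z zy dz] := parent y (d y).-1; first lia.
have [||x dx xz] := IHm z; try lia.
exists x => //; apply: connect_trans xz (connect1 _).
by rewrite /down zy dz prednK //; lia.
Qed.

Lemma root_ancestor y : connect down r y.
Proof.
case: dP => d0 _ _; have [x dx xy] := ancestor (leq0n (d y)).
by have := d0 x; rewrite dx eqxx => /esym/eqP <-.
Qed.

(** A shortest path from the root, indexed by depth; the values of [v] beyond [D] are arbitrary. *)
Definition geodesic (D : nat) (v : nat -> G) : Prop :=
  (forall i, i <= D -> d (v i) = i) /\ (forall i, i < D -> edge (v i) (v i.+1)).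

Lemma geodesic_edge D v i j : geodesic D v -> i <= D -> j <= D ->
  edge (v i) (v j) = (j == i.+1) || (i == j.+1).
Proof.
move=> [vd ve] iD jD.
have [jE|ji] := eqVneq j i.+1; first by rewrite jE; apply: ve; lia.
have [iE|ij] := eqVneq i j.+1; first by rewrite iE edge_sym ve ?orbT //; lia.
apply/negP=> /= e; have [] := depth_edge e; rewrite !vd // => le1 le2.
have ij' : i = j by lia.
by rewrite ij' edge_irr in e.
Qed.

Lemma geodesic_subst D v j y : geodesic D v -> 0 < j < D -> d y = j ->
  edge y (v j.-1) -> edge y (v j.+1) ->
  geodesic D (fun i => if i == j then y else v i).
Proof.
move=> [vd ve] jD dy y1 y2; split=> i iD.
  by have [->|] := eqVneq i j => // _; apply: vd.
have [->|ij] := eqVneq i j; first by rewrite gtn_eqF.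
have [jE|ij'] := eqVneq i.+1 j; last exact: ve.
by rewrite edge_sym; move: y1; rewrite (_ : j.-1 = i) //; lia.
Qed.

(** A downward path from the root to [a] is continued by one from [a] to [w]. The last clause
    records that the second piece stays among the descendants of [a]. *)
Lemma geodesic_through a w : connect down a w ->
  exists v, [/\ geodesic (d w) v, v (d a) = a
    & forall i, d a <= i <= d w -> connect down a (v i)].
Proof.
have geo x y : connect down x y -> exists v : nat -> G,
    [/\ v (d x) = x, v (d y) = y, forall i, d x <= i <= d y -> d (v i) = i
     & forall i, d x <= i < d y -> edge (v i) (v i.+1)].
  move=> /connectP[p pp ->]; have dl := down_path_depth pp.
  elim/last_ind: p => [|p z IHp] in pp dl *.
    by exists (fun=> x); split=> // i /=; lia.
  move: pp dl; rewrite rcons_path last_rcons size_rcons => /andP[pp /andP[ez dz]] dl.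
  have [v [vx vl vd ve]] := IHp pp (down_path_depth pp).
  exists (fun i => if i == d z then z else v i); rewrite eqxx; split=> // [|i|i].
  - by rewrite ltn_eqF //; lia.
  - move=> iD; have [-> //|iz] := eqVneq i (d z); apply: vd.
    by rewrite (eqP dz) in iD iz; lia.
  - move=> iD; rewrite ltn_eqF; last lia.
    have [iz|iz] := eqVneq i.+1 (d z); last first.
      by apply: ve; rewrite (eqP dz) in iD iz; lia.
    by rewrite (_ : i = d (last x p)) ?vl //; rewrite (eqP dz) in iz; lia.
move=> aw; have [u [u0 ua ud ue]] := geo _ _ (root_ancestor a).
have [v [va vw vd ve]] := geo _ _ aw.
have dr : d r = 0 by case: dP => d0 _ _; apply/eqP; rewrite d0.
have law := connect_down_depth aw.
exists (fun i => if i <= d a then u i else v i); split.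
- split=> i iw; first by case: leqP => ia; [apply: ud | apply: vd]; lia.
  case: (ltngtP i (d a)) => ia; [by apply: ue; lia | by apply: ve; lia |].
  by rewrite ia ua -{1}va; apply: ve; lia.
- by rewrite leqnn.
- elim=> [|i IHi] iw.
    have da0 : d a = 0 by lia.
    by move: ua; rewrite da0 /= => ->; apply: connect0.
  case: (ltngtP i.+1 (d a)) => ia; first lia; last by rewrite ia ua connect0.
  have IH := IHi ltac:(lia); apply: connect_trans IH (connect1 _).
  have e : edge (v i) (v i.+1) by apply: ve; lia.
  have [di di1] : d (v i) = i /\ d (v i.+1) = i.+1 by split; apply: vd; lia.
  rewrite /down; case: leqP => ia'; last by rewrite e di di1 eqxx.
  have ea : i = d a by lia.
  by rewrite -ea in ua va; rewrite ua di1 -ea -{1}va e eqxx.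
Qed.

End Geodesics.

(** * Vertices adjacent to a geodesic *)

Section Twins.
Variables (G : sgraph) (r : G) (d : G -> nat) (n : nat).
Hypothesis dP : bfs_depth r d.
Hypotheses (noF1 : ~ embeds (F1 n) G) (noF2 : ~ embeds (F2 n) G).

(** A window of the geodesic starting at depth [q] is an induced path, and [x] becomes its only
    tooth. With a single tooth the spacing [0] places it at [c]. *)
Lemma comb_embeds_geodesic D v (x : G) q L c b1 b2 b3 :
  geodesic d D v -> q + L <= D.+1 -> (forall i, i <= D -> x != v i) ->
  (forall j, j < L -> edge x (v (q + j)) = attached b1 b2 b3 c j) ->
  embeds (comb L 1 0 c b1 b2 b3) G.
Proof.
move=> vP qL xv xe.
have vI i j : i <= D -> j <= D -> v i = v j -> i = j.
  by move=> iD jD e; rewrite -(proj1 vP i iD) e (proj1 vP).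
exists (fun u : comb L 1 0 c b1 b2 b3 => if u is inl j then v (q + j) else x).
  move=> [i|i] [j|j] /=; last by rewrite (ord1 i) (ord1 j).
  - have := ltn_ord i; have := ltn_ord j => jL iL /vI e.
    by congr inl; apply: ord_inj; have := e ltac:(lia) ltac:(lia); lia.
  - by move=> e; have := xv (q + i); rewrite e eqxx => H; have := ltn_ord i; lia.
  - by move=> e; have := xv (q + j); rewrite e eqxx => H; have := ltn_ord j; lia.
move=> [i|i] [j|j]; rewrite comb_edge /= ?orbF.
- have := ltn_ord i; have := ltn_ord j => jL iL.
  by rewrite (geodesic_edge dP vP); lia.
- by rewrite edge_sym xe.
- by rewrite xe.
- by rewrite edge_irr.
Qed.

Lemma attached_geodesic D v x : geodesic d D v -> 0 < d x -> x != v (d x) ->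
  forall i, i <= D -> x != v i /\
    edge x (v i) = attached (edge x (v (d x).-1)) (edge x (v (d x)))
                            (edge x (v (d x).+1)) (d x) i.
Proof.
move=> vP x0 xv i iD; have di := proj1 vP i iD; split.
  by apply: contraNneq xv => e; rewrite {1}e -{1}di -e.
rewrite /attached.
have [e1|n1] := eqVneq i.+1 (d x).
  by rewrite (_ : (d x).-1 = i) ?andbT; lia.
have [->|n2] := eqVneq i (d x).
  by rewrite andbT andbF /= [_ == _]ltn_eqF ?andbF ?orbF.
have [->|n3] := eqVneq i (d x).+1; first by rewrite !andbF andbT.
rewrite !andbF; apply/negP=> /(depth_edge dP); rewrite di => -[]; lia.
Qed.

Lemma twin D v x i : geodesic d D v -> n < d x -> d x + n < D ->
  x != v (d x) -> i <= D -> edge x (v i) ->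
  edge x (v (d x).-1) /\ edge x (v (d x).+1).
Proof.
move=> vP nx xD xv iD xi.
have att := attached_geodesic vP (leq_ltn_trans (leq0n n) nx) xv.
have xvi j : j <= D -> x != v j by move=> /att[].
have {}att j (jD : j <= D) := proj2 (att j jD).
have := att _ iD; rewrite {}xi.
(* Of the eight adjacency patterns, the empty one contradicts the given edge and those containing
   both outer vertices are the conclusion. A single neighbour yields [F1] and two consecutive ones
   yield [F2]. Each offset [q] centres the window at these neighbours; the depth hypotheses leave
   room for it on both sides. *)
case: (edge x (v (d x).-1)) (edge x (v (d x))) (edge x (v (d x).+1)) att
  => [] [] [] att ati //; exfalso.
- apply: noF2; apply: embeds_trans (embeds_F2 n) _.
  apply: (comb_embeds_geodesic (x := x) (q := d x - n) vP) => [|//|j jL]; first lia.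
  by rewrite att /attached; lia.
- apply: noF1; apply: embeds_trans (embeds_F1 n) _.
  apply: (comb_embeds_geodesic (x := x) (q := d x - n.+1) vP) => [|//|j jL]; first lia.
  by rewrite att /attached; lia.
- apply: noF2; apply: embeds_trans (embeds_F2 n) _.
  apply: (comb_embeds_geodesic (x := x) (q := d x - n.-1) vP) => [|//|j jL]; first lia.
  by rewrite att /attached; lia.
- apply: noF1; apply: embeds_trans (embeds_F1 n) _.
  apply: (comb_embeds_geodesic (x := x) (q := d x - n) vP) => [|//|j jL]; first lia.
  by rewrite att /attached; lia.
- apply: noF1; apply: embeds_trans (embeds_F1 n) _.
  apply: (comb_embeds_geodesic (x := x) (q := (d x).+1 - n) vP) => [|//|j jL];
    first lia.
  by rewrite att /attached; lia.
Qed.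

(** By [twin], only two patterns remain: [F5] if [x] is adjacent to the vertex it could replace, and
    [F4] otherwise. *)
Lemma no_twin D v x i : ~ embeds (F4 n) G -> ~ embeds (F5 n) G ->
  geodesic d D v -> n < d x -> d x + n < D -> i <= D -> edge x (v i) ->
  x = v (d x).
Proof.
move=> noF4 noF5 vP nx xD iD xi; apply: contrapT => /eqP xv.
have [x1 x3] := twin vP nx xD xv iD xi.
have att := attached_geodesic vP (leq_ltn_trans (leq0n n) nx) xv.
have xvi j : j <= D -> x != v j by move=> /att[].
rewrite x1 x3 in att; have {}att j (jD : j <= D) := proj2 (att j jD).
case: (edge x (v (d x))) att => att.
- apply: noF5; apply: embeds_trans (embeds_F5 n) _.
  apply: (comb_embeds_geodesic (x := x) (q := d x - n) vP) => [|//|j jL]; first lia.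
  by rewrite att /attached; lia.
- apply: noF4; apply: embeds_trans (embeds_F4 n) _.
  apply: (comb_embeds_geodesic (x := x) (q := d x - n) vP) => [|//|j jL]; first lia.
  by rewrite att /attached; lia.
Qed.

Section Layers.
Variables (a : G) (D : nat) (v : nat -> G).
Hypotheses (da : d a = n.+1) (vP : geodesic d D v) (va : v n.+1 = a).

(* The parent y of x is itself a twin of v (d y), so the twin lemma may also be
   applied to the geodesic in which y replaces v (d y). *)
Lemma layer_twin x : connect (down d) a x -> d x <= maxn n.+1 (D - n.+1) ->
  x = v (d x) \/ [/\ n.+1 < d x, d x + n < D, edge x (v (d x).-1)
                   & edge x (v (d x).+1)].
Proof.
have [k] := ubnP (d x); elim: k => // k IHk in x *; rewrite ltnS => xk ax xE.
have := connect_down_depth ax; rewrite da => nx.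
have [xn|xn] := leqP (d x) n.+1.
  left; rewrite -(connect_down_eq ax) ?da ?va //.
have [|y [ay yx dy]] := connect_down_pred ax; first by rewrite da.
have [//|xv] := eqVneq x (v (d x)); first by left.
have xD : d x + n < D by lia.
suff [x1 x3] : edge x (v (d x).-1) /\ edge x (v (d x).+1) by right.
have twin_at i : i <= D -> edge x (v i) -> _ := twin vP nx xD xv.
have [||yv|[ny yD y1 y3]] := IHk y _ ay; try lia.
  by apply: (twin_at (d y)); [lia | rewrite -yv edge_sym].
have wP : geodesic d D (fun i => if i == d y then y else v i).
  by apply: geodesic_subst => //; lia.
have [|||_] := twin (x := x) (i := d y) wP nx xD.
- by rewrite gtn_eqF //; lia.
- lia.
- by rewrite eqxx edge_sym.
rewrite gtn_eqF => [xe|]; last lia.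
by apply: twin_at xe; lia.
Qed.

(** If neither vertex is on the geodesic, put [x] in place of [v (d x)]. Then [y] is still adjacent
    to the vertex at depth [(d y).+1], so [twin] makes it adjacent also to the one at depth [d x],
    which is now [x]. *)
Lemma layer_complete x y : connect (down d) a x -> connect (down d) a y ->
  d y = (d x).+1 -> d y <= maxn n.+1 (D - n.+1) -> edge x y.
Proof.
move=> ax ay dxy yE; have := connect_down_depth ax; rewrite da => nx.
have [|xv|[x1 x2 x3 x4]] := layer_twin ax; first lia.
  have [//|->|[_ _]] := layer_twin ay; last by rewrite dxy /= -xv edge_sym.
  by rewrite dxy {1}xv; apply: (proj2 vP); lia.
have [//|->|[y1 y2 y3 y4]] := layer_twin ay; first by rewrite dxy.
have [->|yv] := eqVneq y (v (d y)); first by rewrite dxy.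
have wP : geodesic d D (fun i => if i == d x then x else v i).
  by apply: geodesic_subst => //; lia.
have [||||] := twin (x := y) (i := (d y).+1) wP _ y2.
- lia.
- by rewrite gtn_eqF //; lia.
- lia.
- by rewrite gtn_eqF //; lia.
- by rewrite dxy /= eqxx edge_sym.
Qed.

Lemma layer_single x : ~ embeds (F4 n) G -> ~ embeds (F5 n) G ->
  connect (down d) a x -> d x <= maxn n.+1 (D - n.+1) -> x = v (d x).
Proof.
move=> noF4 noF5 ax xE; have [//|[nx xD x1 x2]] := layer_twin ax xE.
by apply: no_twin vP _ xD _ x2 => //; lia.
Qed.

(** Going up from [v j] to [b], each predecessor is adjacent to the geodesic and hence lies on it by
    [no_twin]; at depth [n.+1] this gives [a]. This will make the paths of different starting
    vertices disjoint. *)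
Lemma layer_root b j : ~ embeds (F4 n) G -> ~ embeds (F5 n) G ->
  n < j <= maxn n.+1 (D - n.+1) -> d b = n.+1 -> connect (down d) b (v j) ->
  n < D -> b = a.
Proof.
move=> noF4 noF5 + db + nD; elim: j => [|j IHj] // jE bv.
have djE : d (v j.+1) = j.+1 by apply: (proj1 vP); lia.
have [jn|jn] := eqVneq j n.
  by rewrite (connect_down_eq bv) ?djE ?jn ?va // db.
have [|y [dby yv dy]] := connect_down_pred bv; first by rewrite djE; lia.
apply: IHj; first lia.
suff <- : y = v j by [].
have dyj : d y = j by lia.
by rewrite (no_twin (i := j.+1) noF4 noF5 vP (x := y)) ?dyj //; lia.
Qed.

End Layers.
End Twins.

(** * Balls in graphs of bounded degree *)

Section Balls.
Variables (G : sgraph) (M : nat).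
Hypothesis degM : forall x : G, #|[set y | edge x y]| < M.

Definition ball k (x : G) : {set G} :=
  iter k (fun A : {set G} => \bigcup_(y in A) (y |: [set z | edge y z])) [set x].

Lemma card_bigcup_le (I T : finType) (A : {set I}) (F : I -> {set T}) m :
  (forall i, #|F i| <= m) -> #|\bigcup_(i in A) F i| <= #|A| * m.
Proof.
move=> Fm; rewrite -sum_nat_const.
elim/big_rec2: _ => [|i k B _ IH]; first by rewrite cards0.
by rewrite (leq_trans (leq_card_setU _ _)) // leq_add.
Qed.

(** Degrees are strictly below [M], so a closed neighbourhood has at most [M] vertices. *)
Lemma card_ball k x : #|ball k x| <= M ^ k.
Proof.
elim: k => [|k IHk] /=; first by rewrite cards1.
rewrite expnS mulnC; apply: leq_trans (card_bigcup_le _ (m := M) _) _.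
  move=> y; rewrite cardsU1; have := degM y; lia.
by rewrite leq_mul2r IHk orbT.
Qed.

Lemma ball0 x : x \in ball 0 x. Proof. exact: set11. Qed.

Lemma ballS k x y : y \in ball k x -> y \in ball k.+1 x.
Proof. by move=> yB; apply/bigcupP; exists y; rewrite // setU11. Qed.

Lemma ball_edge k x y z : y \in ball k x -> edge y z -> z \in ball k.+1 x.
Proof. by move=> yB yz; apply/bigcupP; exists y; rewrite // !inE yz orbT. Qed.

Lemma ball_le k m x y : k <= m -> y \in ball k x -> y \in ball m x.
Proof.
move=> km yB; rewrite -(subnK km); elim: (m - k) => // i IHi; exact: ballS.
Qed.

Lemma ball_down (d : G -> nat) k m x y z : y \in ball k x ->
  connect (down d) y z -> d z <= d y + m -> z \in ball (k + m) x.
Proof.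
move=> yB /connectP[p pp ->]; rewrite (down_path_depth pp) leq_add2l => pm.
apply: (@ball_le (k + size p)); first by rewrite leq_add2l.
elim: p {pm} => [|w p IHp] /= in k y yB pp *; first by rewrite addn0.
move: pp => /andP[/andP[yw _] wp].
by rewrite addnS -addSn; apply: IHp wp; apply: ball_edge yB yw.
Qed.

End Balls.

Lemma path_iota (T : Type) (e : rel T) (f : nat -> T) m k :
  (forall j, m <= j < m + k -> e (f j) (f j.+1)) ->
  path e (f m) (map f (iota m.+1 k)).
Proof.
elim: k m => //= k IHk m fe; rewrite fe ?IHk //; last lia.
by move=> j jm; apply: fe; lia.
Qed.

Lemma isometric1 (G : sgraph) (x : G) : isometric [:: x].
Proof. by exists x, x; split; [rewrite /= !eqxx | case]. Qed.

Lemma deepest_descendant (G : sgraph) (d : G -> nat) (a : G) :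
  exists2 w, connect (down d) a w & forall u, connect (down d) a u -> d u <= d w.
Proof.
have [w aw wmax] := @arg_maxnP G a (connect (down d) a) d (connect0 _ a).
by exists w.
Qed.

(** * Upper bounds *)

Section Upper.
Variables (G : sgraph) (r : G) (d : G -> nat) (n M : nat).
Hypothesis dP : bfs_depth r d.
Hypothesis degM : forall x : G, #|[set y | edge x y]| < M.
Hypotheses (noF1 : ~ embeds (F1 n) G) (noF2 : ~ embeds (F2 n) G).

(** The common input of both upper bounds. The geodesic leads to a deepest descendant of [a]; layers
    up to depth [E] are controlled by twins, and what lies deeper is confined to one ball. *)
Lemma descendant_layers a : d a = n.+1 -> exists v E,
  [/\ n < E, geodesic d E v, v n.+1 = a &
   [/\ forall j, n < j <= E -> connect (down d) a (v j),
      forall x, connect (down d) a x -> d x <= E ->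
        x = v (d x) \/ edge (v (d x).-1) x,
      forall x y, connect (down d) a x -> connect (down d) a y ->
        d y = (d x).+1 -> d y <= E -> edge x y,
      forall x, connect (down d) a x -> E < d x -> x \in ball n.+3 (v E)
    & ~ embeds (F4 n) G -> ~ embeds (F5 n) G ->
      (forall x, connect (down d) a x -> d x <= E -> x = v (d x)) /\
      (forall b j, d b = n.+1 -> n < j <= E -> connect (down d) b (v j) -> b = a)]].
Proof.
move=> da; have [w aw wmax] := deepest_descendant d a.
have [v [vP va vdown]] := geodesic_through dP aw; rewrite da in va vdown.
have nD : n < d w by rewrite -da connect_down_depth.
have lt x ax xE := layer_twin dP noF1 noF2 da vP va (x := x) ax xE.
have lt' x : connect (down d) a x -> d x <= maxn n.+1 (d w - n.+1) ->
    x = v (d x) \/ edge (v (d x).-1) x.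
  by move=> ax /(lt _ ax)[|[_ _ + _]]; [left | right; rewrite edge_sym].
(* Depth at most [d w - n.+1] leaves the room that [twin] needs. The maximum keeps the layer of [a]
   in range when [w] is not deep; then that layer, which is [a] alone, is all that is claimed. *)
exists v, (maxn n.+1 (d w - n.+1)).
split=> //; first lia.
  by split=> i iE; [apply: (proj1 vP) | apply: (proj2 vP)]; lia.
split=> //.
- by move=> j jE; apply: vdown; lia.
- move=> x y; exact: (layer_complete dP noF1 noF2 da vP va).
- move=> x ax xE; have := wmax _ ax => xw.
  (* The ancestor [z] of [x] at depth [E] equals [v E] or shares with it the neighbour [v E.-1], and
     [x] is at most [n.+1] levels below [z]: in total radius [2 + n.+1]. *)
  have [|z [az zx dz]] := connect_down_ancestor (k := maxn n.+1 (d w - n.+1)) ax.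
    by rewrite da; lia.
  rewrite -(add2n n.+1); apply: ball_down zx _; last lia.
  have [|->|[zn zD z1 _]] := lt z az; first by rewrite dz.
    by rewrite dz; apply/ballS/ballS/ball0.
  rewrite -dz; apply: (ball_edge (y := v (d z).-1)); last by rewrite edge_sym.
  apply: (ball_edge (ball0 _)); rewrite edge_sym.
  by have := proj2 vP (d z).-1; rewrite prednK; [apply; lia | lia].
- move=> noF4 noF5; split=> [x|b j db jE bv].
    exact: (layer_single dP noF1 noF2 da vP va).
  exact: (layer_root dP noF1 noF2 da vP va noF4 noF5 jE db bv nD).
Qed.

(** Consecutive layers are completely joined, so choosing one vertex per layer always gives an
    increasing path. The [t]-th path takes the [t]-th vertex of every layer, and [M] paths exhaust
    all layers up to [E]; deeper vertices become singletons. *)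
Lemma cover_descendants a : d a = n.+1 -> exists P : seq (seq G),
  [/\ forall s, s \in P -> isometric s,
      forall x, connect (down d) a x -> exists s, s \in P /\ x \in s
    & size P <= M + M ^ n.+3].
Proof.
move=> /descendant_layers[v [E [nE vP va [vdown twins complete tail _]]]].
pose S j := [set x | connect (down d) a x && (d x == j)].
have vS j : n < j <= E -> v j \in S j.
  by move=> jE; rewrite inE vdown //=; apply/eqP/(proj1 vP); lia.
(* In a layer with too few vertices the choice falls back on the geodesic. *)
pose pick t j := nth (v j) (enum (S j)) t.
have pickS t j : n < j <= E -> pick t j \in S j.
  move=> jE; rewrite /pick; case: (ltnP t (size (enum (S j)))) => tS.
    by rewrite -mem_enum mem_nth.
  by rewrite nth_default // vS.
(* All vertices of a layer except [v j] are neighbours of [v j.-1]. *)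
have cardS j : j <= E -> #|S j| <= M.
  move=> jE; apply: (@leq_trans #|v j |: [set y | edge (v j.-1) y]|).
    apply/subset_leq_card/subsetP=> x; rewrite !inE => /andP[ax /eqP dx].
    have [|xv|xe] := twins x ax; first by rewrite dx.
      by rewrite -dx -xv eqxx.
    by rewrite -dx xe orbT.
  by rewrite cardsU1; have := degM (v j.-1); lia.
pose Q t := pick t n.+1 :: [seq pick t j | j <- iota n.+2 (E - n.+1)].
have QE t : Q t = [seq pick t j | j <- iota n.+1 (E - n)].
  by rewrite (_ : E - n = (E - n.+1).+1) //; lia.
exists ([seq Q t | t <- iota 0 M] ++ [seq [:: x] | x <- enum (ball n.+3 (v E))]).
split.
- move=> s; rewrite mem_cat => /orP[/mapP[t _ ->] | /mapP[x _ ->]];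
    last exact: isometric1.
  apply: (down_path_isometric dP); apply: path_iota => j jE.
  have := @pickS t j; have := @pickS t j.+1; rewrite !inE.
  move=> /(_ ltac:(lia))/andP[aj1 /eqP dj1] /(_ ltac:(lia))/andP[aj /eqP dj].
  by rewrite /down complete ?dj ?dj1 ?eqxx //; lia.
- move=> x ax; have [xE|xE] := leqP (d x) E; last first.
    exists [:: x]; rewrite mem_head mem_cat; split=> //; apply/orP; right.
    by apply: map_f; rewrite mem_enum tail.
  have xS : x \in enum (S (d x)) by rewrite mem_enum inE ax /=.
  have nx : n < d x.
    have := connect_down_depth ax; have := proj1 vP n.+1; rewrite va => -> //; lia.
  exists (Q (index x (enum (S (d x))))); split.
    rewrite mem_cat map_f // mem_iota /= add0n.
    by rewrite (leq_trans _ (cardS _ xE)) // cardE index_mem.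
  rewrite QE; apply/mapP; exists (d x); first by rewrite mem_iota; lia.
  by rewrite /pick nth_index.
- by rewrite size_cat !size_map size_iota -cardE leq_add2l (card_ball degM).
Qed.

Lemma depth_le_ball x : d x <= n.+1 -> x \in ball n.+1 r.
Proof.
move=> xn; rewrite -(add0n n.+1).
by apply: ball_down (ball0 r) (root_ancestor dP x) _; lia.
Qed.

Lemma card_start : #|[set a | d a == n.+1]| <= M ^ n.+1.
Proof.
apply: leq_trans (card_ball degM n.+1 r); apply/subset_leq_card/subsetP=> x.
by rewrite inE => /eqP dx; apply: depth_le_ball; rewrite dx.
Qed.

(** Vertices of depth at most [n.+1] are covered by singletons of a ball around the root; every
    deeper one descends from one of the boundedly many vertices of depth [n.+1]. *)
Lemma isometric_cover_bound : exists P : seq (seq G),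
  isometric_path_cover P /\ size P <= M ^ n.+1 + M ^ n.+1 * (M + M ^ n.+3).
Proof.
have [P PP] : {P : G -> seq (seq G) & forall a, d a = n.+1 ->
    [/\ forall s, s \in P a -> isometric s,
        forall x, connect (down d) a x -> exists s, s \in P a /\ x \in s
      & size (P a) <= M + M ^ n.+3]}.
  apply: (@choice G _ (fun a Pa => d a = n.+1 -> [/\ forall s, s \in Pa -> isometric s,
        forall x, connect (down d) a x -> exists s, s \in Pa /\ x \in s
      & size Pa <= M + M ^ n.+3])) => a.
  have [/cover_descendants[Pa PaP]|na] := eqVneq (d a) n.+1; first by exists Pa.
  by exists [::] => /eqP; rewrite (negPf na).
exists ([seq [:: x] | x <- enum (ball n.+1 r)] ++
        flatten [seq P a | a <- enum [set a | d a == n.+1]]).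
split; first split.
- move=> s; rewrite mem_cat => /orP[/mapP[x _ ->] | /flatten_mapP[a]];
    first exact: isometric1.
  by rewrite mem_enum inE => /eqP /PP[+ _ _]; apply.
- move=> x; have [xn|xn] := leqP (d x) n.+1.
    exists [:: x]; rewrite mem_head mem_cat map_f // mem_enum.
    exact: depth_le_ball.
  have [a da ax] := ancestor dP (ltnW xn); have [_ /(_ x ax)[s [sP xs]] _] := PP a da.
  exists s; rewrite mem_cat; split=> //; apply/orP; right.
  by apply/flatten_mapP; exists a; rewrite // mem_enum inE da.
- rewrite size_cat size_map -cardE; apply: leq_add (card_ball degM _ _) _.
  rewrite size_flatten /shape -map_comp sumnE big_map.
  apply: leq_trans (_ : \sum_(a in [set a | d a == n.+1]) (M + M ^ n.+3) <= _).
    by rewrite big_enum; apply: leq_sum => a; rewrite inE => /eqP/PP[].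
  by rewrite sum_nat_const leq_mul2r card_start orbT.
Qed.

(** Without twins one path per starting vertex suffices. The vertices on none of these paths lie in
    the ball around the root or in the ball at the far end of some path, and become singletons. *)
Lemma isometric_partition_bound : ~ embeds (F4 n) G -> ~ embeds (F5 n) G ->
  exists P : seq (seq G), isometric_path_partition P /\
    size P <= M ^ n.+1 + (M ^ n.+1 + M ^ n.+1 * M ^ n.+3).
Proof.
move=> noF4 noF5.
(* Here [z] is the centre of the ball holding the descendants that [Q] misses. A vertex common to
   the paths of [a] and [b] descends from both, so the last clause gives [a = b]. *)
pose spec a (Q : seq G) z := d a = n.+1 ->
  [/\ isometric Q, forall x, x \in Q -> connect (down d) a x,
      forall x, connect (down d) a x -> x \in Q \/ x \in ball n.+3 z
    & forall b x, d b = n.+1 -> x \in Q -> connect (down d) b x -> b = a].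
have [Q QP] : {Q : G -> seq G * G & forall a, spec a (Q a).1 (Q a).2}.
  apply: (@choice G _ (fun a Q => spec a Q.1 Q.2)) => a.
  have [da|na] := eqVneq (d a) n.+1; last first.
    by exists ([::], r) => /eqP; rewrite (negPf na).
  have [v [E [nE vP va [vdown _ _ tail /(_ noF4 noF5)[single root]]]]] :=
    descendant_layers da.
  have QE : v n.+1 :: [seq v j | j <- iota n.+2 (E - n.+1)] =
            [seq v j | j <- iota n.+1 (E - n)].
    by rewrite (_ : E - n = (E - n.+1).+1) //; lia.
  exists ([seq v j | j <- iota n.+1 (E - n)], v E) => _; split=> /=.
  - rewrite -QE; apply: (down_path_isometric dP); apply: path_iota => j jE.
    by rewrite /down (proj2 vP) ?(proj1 vP) ?eqxx //; lia.
  - by move=> x /mapP[j jE ->]; apply: vdown; move: jE; rewrite mem_iota; lia.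
  - move=> x ax; have [xE|xE] := leqP (d x) E; last by right; apply: tail.
    left; have := connect_down_depth ax; rewrite da => nx.
    by apply/mapP; exists (d x); [rewrite mem_iota; lia | apply: single].
  - move=> b x db /mapP[j jE ->]; apply: root => //.
    by move: jE; rewrite mem_iota; lia.
pose A := [set a | d a == n.+1].
pose rest := [set x | ~~ [exists a in A, x \in (Q a).1]].
exists ([seq (Q a).1 | a <- enum A] ++ [seq [:: x] | x <- enum rest]).
have memA a : (a \in enum A) = (d a == n.+1) by rewrite mem_enum inE.
split; first split; first split.
- move=> s; rewrite mem_cat => /orP[/mapP[a + ->] | /mapP[x _ ->]];
    last exact: isometric1.
  by rewrite memA => /eqP/QP[].
- move=> x; have [xr|] := boolP (x \in rest).
    exists [:: x]; rewrite mem_head mem_cat; split=> //; apply/orP; right.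
    by apply: map_f; rewrite mem_enum.
  rewrite inE negbK => /existsP[a /andP[aA xa]]; exists (Q a).1; split=> //.
  by rewrite mem_cat (map_f (fun a => (Q a).1)) // mem_enum.
- rewrite pairwise_cat; apply/and3P; split.
  + apply/allrelP=> _ _ /mapP[a aA ->] /mapP[x xr ->].
    rewrite disjoint_sym disjoint_has /= orbF; move: xr; rewrite mem_enum inE.
    by apply: contra => xa; apply/existsP; exists a; rewrite -mem_enum aA.
  + rewrite pairwise_map; have : uniq (enum A) by apply: enum_uniq.
    rewrite uniq_pairwise; apply: (@sub_in_pairwise _ [pred a | d a == n.+1]);
      last by apply/allP=> a; rewrite memA.
    move=> a b /eqP da /eqP db ab; rewrite /= disjoint_has; apply: contra ab.
    move=> /hasP[x xa xb]; apply/eqP; have [_ _ _ /(_ a x)] := QP b db; apply=> //.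
    by have [_ + _ _] := QP a da; apply.
  + rewrite pairwise_map; have : uniq (enum rest) by apply: enum_uniq.
    rewrite uniq_pairwise; apply: sub_pairwise => x y /= xy.
    by rewrite disjoint_has /= inE orbF.
- rewrite size_cat !size_map -!cardE; apply: leq_add card_start _.
  apply: (@leq_trans #|ball n.+1 r :|: \bigcup_(a in A) ball n.+3 (Q a).2|).
    apply/subset_leq_card/subsetP=> x; rewrite !inE => /existsPn xr.
    have [/depth_le_ball->//|xn] := leqP (d x) n.+1.
    have [a da ax] := ancestor dP (ltnW xn).
    apply/orP; right; apply/bigcupP; exists a; first by rewrite inE da.
    have [_ _ /(_ x ax)[xQ|//] _] := QP a da.
    by have := xr a; rewrite inE da eqxx xQ.
  apply: leq_trans (leq_card_setU _ _) _; apply: leq_add (card_ball degM _ _) _.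
  apply: leq_trans (card_bigcup_le _ (m := M ^ n.+3) _) _.
    by move=> a; apply: card_ball.
  by rewrite leq_mul2r card_start orbT.
Qed.

End Upper.

(** * Lower bounds *)

(** A one-vertex path lists its vertex twice, so each nonempty path contributes exactly two
    entries. *)
Definition ends (T : Type) (s : seq T) : seq T :=
  if s is x :: p then [:: x; last x p] else [::].

(** Take the predecessor [u] and the successor [w] of [v]: if they were adjacent, skipping [v] would
    shorten the path. The indices record that the three are consecutive, which serves to compare two
    interior vertices of one path. *)
Lemma isometric_interior (G : sgraph) (s : seq G) (v : G) :
  isometric s -> v \in s -> v \notin ends s ->
  exists u w, [/\ [/\ u \in s, w \in s & uniq s], edge u v, edge v w, ~~ edge u w
    & [/\ u != w, index v s = (index u s).+1 & index w s = (index u s).+2]].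
Proof.
move=> [x [y [sP smin]]] /splitPr sE; case: sE sP smin => s1 s2.
case/lastP: s1 => [|s1 u]; first by rewrite /= mem_head.
case: s2 => [|w s2].
  by move=> _ _; case: s1 => [|a t]; rewrite /= ?last_cat !inE eqxx ?orbT.
rewrite -cats1 -catA /= => sP smin _; exists u, w.
have su : uniq (s1 ++ [:: u, v, w & s2]).
  by case: (s1) sP => [|a t] /= /and4P[].
have ord : [/\ edge u v, edge v w & ~~ edge u w].
  case: s1 su sP smin => [|a t] su /=.
    move=> /and4P[ux /eqP wy /and3P[-> -> ws] _] smin; split=> //; apply/negP=> uw.
    have := smin [:: u, w & s2]; rewrite /= ux wy eqxx uw ws.
    move: su; rewrite /= !inE !negb_or => /and4P[/and3P[_ -> ->] _ -> ->] /(_ isT).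
    by rewrite ltnn.
  move=> /and4P[ax]; rewrite last_cat cat_path /= => /eqP wy.
  move=> /and5P[pt lu -> -> ws] _ smin; split=> //; apply/negP=> uw.
  have := smin (a :: t ++ [:: u, w & s2]); rewrite /= ax last_cat cat_path /=.
  rewrite wy eqxx pt lu uw ws.
  have : uniq (a :: t ++ [:: u, w & s2]).
    apply: subseq_uniq su; rewrite -cat_cons cat_subseq //.
    by rewrite (@cat_subseq _ [:: u] (w :: s2) [:: u]) ?subseq_cons.
  move=> /= ->.
  by move=> /(_ isT); rewrite !size_cat /=; lia.
case: ord => uv vw uw; split=> //.
  by split=> //; rewrite mem_cat !inE eqxx ?orbT.
move: su; rewrite cat_uniq /= !inE !negb_or.
move=> /and3P[_ /and4P[u1 v1 w1 _]] /and4P[/and3P[uv' uw' _] /andP[vw' _] _ _].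
rewrite !index_cat (negPf u1) (negPf v1) (negPf w1) /= !eqxx.
by rewrite uw' (negPf uv') (negPf uw') (negPf vw') !addnS addn0.
Qed.

(* Every path has two ends, so the paths of a family hit few gadgets in an end. *)
Lemma endpoint_count (G : sgraph) m (gadget : 'I_m -> G -> Prop) (P : seq (seq G)) :
  (forall i j x, gadget i x -> gadget j x -> i = j) ->
  (forall i, exists s x, [/\ s \in P, gadget i x & x \in ends s]) ->
  m <= (size P).*2.
Proof.
move=> gI gE.
have [e eP] : {e : 'I_m -> G & forall i, gadget i (e i) /\
                                 e i \in flatten (map (@ends G) P)}.
  apply: (@choice _ _ (fun i x => gadget i x /\ x \in _)) => i.
  have [s [x [sP gx xs]]] := gE i; exists x; split=> //.
  by apply/flatten_mapP; exists s.
rewrite -[m in m <= _]card_ord cardE -(size_map e).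
apply: (@leq_trans (size (flatten (map (@ends G) P)))).
  apply: uniq_leq_size => [|_ /mapP[i _ ->]]; last by have [] := eP i.
  rewrite map_inj_uniq ?enum_uniq // => i j eij.
  by have [gi _] := eP i; have [gj _] := eP j; rewrite eij in gi; apply: gI gi gj.
elim: (P) => //= -[|x s] Q IHQ; rewrite size_cat /=; lia.
Qed.

Definition simplicial (G : sgraph) (v : G) : Prop :=
  forall u w, u != w -> edge v u -> edge v w -> edge u w.

Lemma simplicial_end (G : sgraph) (s : seq G) (v : G) :
  isometric s -> v \in s -> simplicial v -> v \in ends s.
Proof.
move=> sI vs vS; apply/negPn/negP=> /(isometric_interior sI vs).
move=> [u [w [_ uv vw /negP uw [neq _ _]]]]; apply: uw.
by apply: vS neq _ vw; rewrite edge_sym.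
Qed.

Lemma cover_simplicial (G : sgraph) m (f : 'I_m -> G) (P : seq (seq G)) :
  injective f -> (forall i, simplicial (f i)) -> isometric_path_cover P ->
  m <= (size P).*2.
Proof.
move=> fI fS [PI PC]; apply: (@endpoint_count _ _ (fun i x => x = f i)).
  by move=> i j x -> /fI.
move=> i; have [s [sP fs]] := PC (f i); exists s, (f i); split=> //.
by apply: simplicial_end => //; apply: PI.
Qed.

Lemma Kn_simplicial n (v : Kn n) : simplicial v.
Proof. by move=> u w uw _ _; rewrite /= /symc_edge uw. Qed.

Lemma K1n_simplicial n (i : 'I_n) : simplicial (Some i : K1n n).
Proof.
have irr : irreflexive (fun u v : option 'I_n => ~~ isSome u && isSome v) by case.
by move=> [u|] [w|] //; rewrite /= !symc_edgeE.
Qed.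

(** Without the left neighbour a tooth is adjacent to at most two spine vertices, and these are
    consecutive. *)
Lemma comb_simplicial L m K c b2 b3 (i : 'I_m) :
  simplicial (inr i : comb L m K c false b2 b3).
Proof.
move=> [u|u] [w|w] //; rewrite !comb_edge //= /attached -[inl u == inl w]/(u == w).
by rewrite -val_eqE /=; lia.
Qed.

Lemma pairwise_disjoint_eq (T : finType) (P : seq (seq T)) s t x :
  pairwise (fun s t : seq T => [disjoint s & t]) P ->
  s \in P -> t \in P -> x \in s -> x \in t -> s = t.
Proof.
elim: P => //= p P IHP /andP[/allP pP PP]; rewrite !inE.
have dis q : q \in P -> x \in p -> x \in q -> False.
  by move=> /pP; rewrite disjoint_has => /hasPn H xp; apply/negP/H.
move=> /predU1P[->|sP] /predU1P[->|tP] xs xt //; try exact: IHP.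
  by case: (dis t).
by case: (dis s).
Qed.

(* If neither twin of the i-th pair is an end, then both common neighbours of
   the twins lie, in one path, right before and after each of the two. *)
Lemma partition_comb L m K c b2 (P : seq (seq (comb L m K c true b2 true))) :
  1 < K -> (forall i : 'I_m, K * i + c < L) ->
  isometric_path_partition P -> m <= (size P).*2.
Proof.
move=> K1 pL [[PI PC] PD].
pose pos (i : 'I_m) : 'I_L := Ordinal (pL i).
apply: (@endpoint_count (comb L m K c true b2 true) _
          (fun i x => x = inr i \/ x = inl (pos i))).
  have posI i j : pos i = pos j -> i = j.
    move=> /(congr1 val) /= /addIn /eqP; rewrite eqn_mul2l => /orP[|/eqP]; first lia.
    exact: ord_inj.
  by move=> i j x [->|->] [] // [] // e; apply/posI/ord_inj.
move=> i; apply: contrapT => noend.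
have no x : x = inr i \/ x = inl (pos i) -> forall s, s \in P -> x \notin ends s.
  by move=> xi s sP; apply/negP=> xe; apply: noend; exists s, x.
have sides (x u w : comb L m K c true b2 true) : x = inr i \/ x = inl (pos i) ->
    edge u x -> edge x w -> ~~ edge u w -> u != w ->
    exists ju jw : 'I_L, [/\ u = inl ju, w = inl jw
      & ju.+1 = K * i + c /\ jw = (K * i + c).+1 :> nat \/
        jw.+1 = K * i + c /\ ju = (K * i + c).+1 :> nat].
  (* Positions of distinct teeth differ by at least [K > 1], so no other tooth is attached at the
     position of the [i]-th. *)
  have adj k : attached true b2 true (K * k + c) (K * i + c) -> k = i :> nat.
    rewrite /attached => H.
    have : (K * k + c <= (K * i + c).+1) && (K * i + c <= (K * k + c).+1) by lia.
    have : k != i -> K * (minn k i).+1 <= K * maxn k i by rewrite leq_mul2l; lia.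
    by case: (ltngtP k i) => // ki; rewrite mulnS; lia.
  case=> ->; case: u => [u|u]; case: w => [w|w]; rewrite !comb_edge //= ?orbF.
  - move=> ux xw uw neq; exists u, w; split=> //.
    have {}neq : u != w by [].
    by move: ux xw uw neq; rewrite /attached -val_eqE /=; lia.
  - move=> ux xw uw neq; exists u, w; split=> //.
    have {}neq : u != w by [].
    by move: ux xw uw neq; rewrite -val_eqE /=; lia.
  - by move=> ux /adj ->; rewrite /attached; lia.
  - by move=> /adj ->; rewrite /attached; lia.
  - by move=> /adj ui /adj wi _ /eqP []; congr inr; apply: ord_inj; rewrite ui wi.
have [s [sP bs]] := PC (inr i); have [t [tP tpos]] := PC (inl (pos i)).
have [u [w [[us ws _] ub bw uw [neq ib iw]]]] :=
  isometric_interior (PI s sP) bs (no _ (or_introl erefl) s sP).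
have [u' [w' [[us' ws' _] ub' bw' uw' [neq' ib' iw']]]] :=
  isometric_interior (PI t tP) tpos (no _ (or_intror erefl) t tP).
have [ju [jw [uE wE jE]]] := sides _ _ _ (or_introl erefl) ub bw uw neq.
have [ju' [jw' [uE' wE' jE']]] := sides _ _ _ (or_intror erefl) ub' bw' uw' neq'.
(* The two twins have the same neighbours on their paths, so disjointness forces [s = t]. In equal
   order both twins would have the same index; in opposite order [u] and [w] would each come before
   the other. *)
have [[e1 e2]|[e1 e2]] : (u = u' /\ w = w') \/ (u = w' /\ w = u').
- rewrite uE wE uE' wE'; move: jE jE'; move: (K * i + c) => p; clear.
  by case=> [[? ?]|[? ?]] [[? ?]|[? ?]]; [left|right|right|left];
    split; congr inl; apply: ord_inj; lia.
- have st : s = t by apply: (pairwise_disjoint_eq PD sP tP us); rewrite e1.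
  rewrite -st in tpos ib'; rewrite -e1 -ib in ib'.
  by move/(congr1 (nth u s)): ib'; rewrite !nth_index.
- have st : s = t by apply: (pairwise_disjoint_eq PD sP tP us); rewrite e1.
  by move: iw iw'; rewrite -st e1 e2; clear; lia.
Qed.

Lemma comb_connected L m K c b1 b2 b3 : 0 < L -> b2 || b3 ->
  (forall i : 'I_m, (K * i + c).+1 < L) -> connected (comb L m K c b1 b2 b3).
Proof.
move=> L0 b23 pL; set G := comb _ _ _ _ _ _ _.
have root (x : G) : connect (@edge G) (inl (Ordinal L0)) x.
  have spine k (kL : k < L) : connect (@edge G) (inl (Ordinal L0)) (inl (Ordinal kL)).
    elim: k kL => [|k IHk] kL; first by rewrite (bool_irrelevance kL L0) connect0.
    apply: connect_trans (IHk (ltnW kL)) (connect1 _).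
    by rewrite comb_edge /= eqxx.
  case: x => [[k kL]|i]; first exact: spine.
  have [b2T|b2F] := boolP b2.
    apply: connect_trans (spine _ (ltnW (pL i))) (connect1 _).
    by rewrite comb_edge /= /attached b2T eqxx orbT.
  apply: connect_trans (spine _ (pL i)) (connect1 _).
  by move: b23; rewrite comb_edge /= /attached (negPf b2F) /= => ->; rewrite eqxx !orbT.
split; first by apply/card_gt0P; exists (inl (Ordinal L0)).
by move=> x y; apply: connect_trans (root y); rewrite (sym_connect_sym (@edge_sym G)).
Qed.

Definition comb_pos L m K c (x : 'I_L + 'I_m) : nat :=
  match x with inl j => j | inr i => K * i + c end.

(** Positions change by at most one along an edge, so the image of [F] spans fewer than [#|F|] steps
    along the spine. As teeth are [K] apart it meets at most one, and a translation moves that tooth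
    to [c']. *)
Lemma comb_window (F : sgraph) L m K c b1 b2 b3 L' c' : connected F ->
  embeds F (comb L m K c b1 b2 b3) -> #|F| <= K -> #|F| <= c'.+1 ->
  c' + #|F| <= L'.+1 -> embeds F (comb L'.+1 1 0 c' b1 b2 b3).
Proof.
move=> [F0 Fc] [f fI fE]; have := F0; move NE: #|F| => N N0 FK Fc' FL'.
pose pos := comb_pos (L := L) (m := m) K c.
have pos_edge (x y : comb L m K c b1 b2 b3) : edge x y -> pos y <= (pos x).+1.
  by rewrite comb_edge; case: x y => [x|x] [y|y]; rewrite /= /attached; lia.
have dist u v : pos (f v) < pos (f u) + N.
  have /connectP[p0 pp0 ->] := Fc u v.
  case/shortenP: pp0 => p pp pu _.
  have pF : size (u :: p) <= N by rewrite -NE -(card_uniqP pu) max_card.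
  suff : pos (f (last u p)) <= pos (f u) + size p by move: pF => /=; lia.
  elim: p u pp {pu pF} => [|w p IHp] u /=; first by rewrite addn0.
  move=> /andP[uw /IHp wp]; apply: leq_trans wp _.
  by rewrite addnS -addSn leq_add2r pos_edge // fE.
(* [u0] is mapped to the only tooth met, or is arbitrary if no tooth is met. *)
have [u0 u0P] : exists u0, forall u i, f u = inr i -> K * i + c = pos (f u0).
  have [[u0 [i0 fu0]]|noext] := pselect (exists u0 i0, f u0 = inr i0); last first.
    have /card_gt0P[u0 _] := F0; exists u0 => u i fu.
    by case: noext; exists u, i.
  exists u0 => u i fu; have := dist u u0; have := dist u0 u; rewrite fu0 fu /=.
  case: (ltngtP i i0) => [ii|ii|->] // *; exfalso.
    have : K * i.+1 <= K * i0 by rewrite leq_mul2l ii orbT.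
    by rewrite mulnS; lia.
  have : K * i0.+1 <= K * i by rewrite leq_mul2l ii orbT.
  by rewrite mulnS; lia.
pose q := pos (f u0).
(* The translation sends position [q] to [c']; [gpos] ensures that the subtraction is not truncated
   and that [inord] receives a valid index. *)
pose g u : comb L'.+1 1 0 c' b1 b2 b3 :=
  match f u with inl j => inl (inord (j + c' - q)) | inr _ => inr ord0 end.
have gpos u j : f u = inl j -> q <= j + c' /\ j + c' - q < L'.+1.
  by move=> fu; have := dist u u0; have := dist u0 u; rewrite -/q fu /=; lia.
exists g.
  move=> u w; rewrite /g; case fu: (f u) => [j|i]; case fw: (f w) => [k|k] //.
    have [j1 j2] := gpos _ _ fu; have [k1 k2] := gpos _ _ fw.
    move=> [] /(congr1 val); rewrite /= !inordK // => jk.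
    by apply: fI; rewrite fu fw; congr inl; apply: ord_inj; lia.
  move=> _; apply: fI; rewrite fu fw; congr inr; apply: ord_inj.
  have := u0P _ _ fu; rewrite -(u0P _ _ fw) => /addIn /eqP.
  by rewrite eqn_mul2l => /orP[|/eqP //]; lia.
move=> u w; rewrite -fE !comb_edge /g.
case fu: (f u) => [j|i]; case fw: (f w) => [k|k] //=.
- have [j1 j2] := gpos _ _ fu; have [k1 k2] := gpos _ _ fw.
  by rewrite !inordK //; lia.
- have [j1 j2] := gpos _ _ fu.
  by rewrite inordK // (u0P _ _ fw) -/q /attached; lia.
- have [k1 k2] := gpos _ _ fw.
  by rewrite inordK // (u0P _ _ fu) -/q /attached; lia.
Qed.

Lemma ispc_cover (G : sgraph) :
  exists P : seq (seq G), isometric_path_cover P /\ size P = ispc G.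
Proof. by rewrite /ispc; case: ex_minnP => k /asboolP. Qed.

Lemma ispp_partition (G : sgraph) :
  exists P : seq (seq G), isometric_path_partition P /\ size P = ispp G.
Proof. by rewrite /ispp; case: ex_minnP => k /asboolP. Qed.

Lemma ispc_le (G : sgraph) (P : seq (seq G)) :
  isometric_path_cover P -> ispc G <= size P.
Proof.
by move=> PC; rewrite /ispc; case: ex_minnP => k _; apply; apply/asboolP; exists P.
Qed.

Lemma ispp_le (G : sgraph) (P : seq (seq G)) :
  isometric_path_partition P -> ispp G <= size P.
Proof.
by move=> PC; rewrite /ispp; case: ex_minnP => k _; apply; apply/asboolP; exists P.
Qed.

Lemma ispc_le_ispp (G : sgraph) : ispc G <= ispp G.
Proof. by have [P [[PC _] <-]] := ispp_partition G; apply: ispc_le. Qed.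

Lemma ispc_simplicial (G : sgraph) m (f : 'I_m -> G) :
  injective f -> (forall i, simplicial (f i)) -> m <= (ispc G).*2.
Proof.
by move=> fI fS; have [P [PC <-]] := ispc_cover G; apply: cover_simplicial fI fS PC.
Qed.

Lemma free_not_embeds HH L F G :
  family_le HH L -> free HH G -> List.In F L -> ~ embeds F G.
Proof.
move=> HL Gfree FL FG; have [F0 [F0H /contains_inducedE F0F]] := HL F FL.
by apply: (Gfree F0 F0H); apply/contains_inducedE; apply: embeds_trans F0F FG.
Qed.

Lemma not_free_embeds HH G :
  ~ free HH G -> exists2 F, List.In F HH & embeds F G.
Proof.
move=> nfree; apply: contrapT => none; apply: nfree => F FH /contains_inducedE FG.
by apply: none; exists F.
Qed.

Lemma contains_induced_member HH F G :
  (exists F0, List.In F0 HH /\ embeds F0 F) -> embeds F G ->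
  exists F0, List.In F0 HH /\ contains_induced G F0.
Proof.
move=> [F0 [F0H F0F]] FG; exists F0; split=> //.
by apply/contains_inducedE; apply: embeds_trans F0F FG.
Qed.

(** * Unavoidable induced subgraphs *)

Section Unavoidable.
Variables (HH : seq sgraph) (mu : sgraph -> nat) (c : nat).
Hypothesis HHconn : forall F, List.In F HH -> connected F.
Hypothesis mu_bound : forall G, connected G -> free HH G -> mu G <= c.

(** [mu] stands for [ispc] or [ispp], so that both parts of the theorem share this section. *)
Lemma unavoidable G : connected G -> c < mu G -> exists2 F, List.In F HH & embeds F G.
Proof.
move=> Gc cG; apply: not_free_embeds => /(mu_bound Gc); lia.
Qed.

(** Finiteness of the family enters here; the bound determines how far apart teeth must be. *)
Lemma order_bound : exists s, forall F, List.In F HH -> #|F| <= s.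
Proof.
elim: (HH) => [|F H [s sP]]; first by exists 0.
exists (maxn #|F| s) => F' [<-|/sP Fs]; first exact: leq_maxl.
exact: leq_trans Fs (leq_maxr _ _).
Qed.

Lemma comb_unavoidable b1 b2 b3 s n L' c' : (forall F, List.In F HH -> #|F| <= s) ->
  b2 || b3 ->
  (forall L m K d, 1 < K -> (forall i : 'I_m, K * i + d < L) ->
     m <= (mu (comb L m K d b1 b2 b3)).*2) ->
  s <= n -> n <= c'.+1 -> c' + n <= L'.+1 ->
  exists F, List.In F HH /\ embeds F (comb L'.+1 1 0 c' b1 b2 b3).
Proof.
(* With [2c + 1] teeth, [low] forces [mu] above [c]. The spacing exceeds the order of every member
   of [HH], and the offset [1] with [K >= 3] keeps both outer neighbours of each attachment on the
   spine. *)
move=> HHs b23 low sn nc nL; pose m := c.*2.+1; pose K := s + 3.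
have pL (i : 'I_m) : (K * i + 1).+1 < K * m.
  have : K * i.+1 <= K * m by rewrite leq_mul2l ltn_ord orbT.
  by rewrite mulnS /K; lia.
have [||F FH FG] := @unavoidable (comb (K * m) m K 1 b1 b2 b3).
- by apply: comb_connected => //; rewrite /K /m; lia.
- suff : m <= (mu (comb (K * m) m K 1 b1 b2 b3)).*2 by rewrite /m; lia.
  by apply: low => [|i]; [rewrite /K; lia | apply: ltnW].
exists F; split=> //; have Fs := HHs F FH.
by apply: comb_window FG _ _ _; rewrite ?/K; [exact: HHconn | lia..].
Qed.

Lemma Kn_unavoidable n : (forall G, ispc G <= mu G) -> c.*2 < n ->
  exists F, List.In F HH /\ embeds F (Kn n).
Proof.
move=> ispc_mu cn; have [||F FH FG] := @unavoidable (Kn n); last by exists F.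
- split; first by rewrite card_ord; lia.
  move=> x y; have [->|xy] := eqVneq x y; first exact: connect0.
  by apply: connect1; rewrite /= /symc_edge xy.
- have := @ispc_simplicial (Kn n) n id (@inj_id _) (@Kn_simplicial n).
  by have := ispc_mu (Kn n); lia.
Qed.

Lemma K1n_unavoidable n : (forall G, ispc G <= mu G) -> c.*2 < n ->
  exists F, List.In F HH /\ embeds F (K1n n).
Proof.
move=> ispc_mu cn; have [||F FH FG] := @unavoidable (K1n n); last by exists F.
- have toN (x : K1n n) : connect (@edge (K1n n)) x None.
    by case: x => [i|]; [apply: connect1 | apply: connect0].
  split; first by apply/card_gt0P; exists None.
  move=> x y; apply: connect_trans (toN x) _.
  by rewrite (sym_connect_sym (@edge_sym (K1n n))).
- have := @ispc_simplicial (K1n n) n Some (@Some_inj _) (@K1n_simplicial n).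
  by have := ispc_mu (K1n n); lia.
Qed.

Lemma family_unavoidable s n : (forall F, List.In F HH -> #|F| <= s) ->
  (forall G, ispc G <= mu G) -> s + c.*2 < n ->
  family_le HH [:: Kn n; K1n n; F1 n; F2 n].
Proof.
move=> HHs ispc_mu sn.
have low L m K d b2 b3 : m <= (mu (comb L m K d false b2 b3)).*2.
  have inrI : injective (@inr 'I_L 'I_m) by move=> i j [].
  have := @ispc_simplicial (comb L m K d false b2 b3) m inr inrI
            (@comb_simplicial L m K d b2 b3).
  by have := ispc_mu (comb L m K d false b2 b3); lia.
have self F : embeds F F by exists id.
move=> F [<-|[<-|[<-|[<-|[]]]]].
- by apply: contains_induced_member (self _); apply: Kn_unavoidable => //; lia.
- by apply: contains_induced_member (self _); apply: K1n_unavoidable => //; lia.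
- by apply: contains_induced_member (fork_embeds_F1 n);
    apply: (comb_unavoidable HHs (n := n)) => //; lia.
- by apply: contains_induced_member (fork2_embeds_F2 _);
    [apply: (comb_unavoidable HHs (n := n)) => // |]; lia.
Qed.

Lemma twin_family_unavoidable s n : (forall F, List.In F HH -> #|F| <= s) ->
  (forall G, ispp G <= mu G) -> s < n -> family_le HH [:: F4 n; F5 n].
Proof.
move=> HHs ispp_mu sn.
have low b2 L m K d : 1 < K -> (forall i : 'I_m, K * i + d < L) ->
    m <= (mu (comb L m K d true b2 true)).*2.
  move=> K1 pL; have [P [PP sP]] := ispp_partition (comb L m K d true b2 true).
  have := partition_comb K1 pL PP; have := ispp_mu (comb L m K d true b2 true).
  by rewrite sP; lia.
move=> F [<-|[<-|[]]].
- by apply: contains_induced_member (fork_embeds_F4 n);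
    apply: (comb_unavoidable HHs (n := n)) => //;
    [exact: low | lia..].
- by apply: contains_induced_member (fork_embeds_F5 n);
    apply: (comb_unavoidable HHs (n := n)) => //;
    [exact: low | lia..].
Qed.

End Unavoidable.

Theorem theorem5p2 (HH : seq sgraph)
    (HHconn : forall F : sgraph, List.In F HH -> connected F) :
  ((exists c : nat, forall G : sgraph,
      connected G -> free HH G -> ispc G <= c) <->
   (exists n : nat, 4 <= n /\
      family_le HH [:: Kn n; K1n n; F1 n; F2 n]))
  /\
  ((exists c : nat, forall G : sgraph,
      connected G -> free HH G -> ispp G <= c) <->
   (exists n : nat, 4 <= n /\
      family_le HH [:: Kn n; K1n n; F1 n; F2 n; F4 n; F5 n])).
Proof.
have [s HHs] := order_bound HH.
split; split.
(* [n] must exceed [s] for the windows in combs, exceed [2c] for [Kn] and [K1n], and be at least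
   [4]. *)
- move=> [c cP]; exists (s + c.*2 + 4); split; first lia.
  by apply: (family_unavoidable HHconn cP HHs) => [G //|]; lia.
(* The constant is read off from [isometric_cover_bound] with [M = 2 ^ (n + n)], so it depends on
   [n] alone. *)
- move=> [n [_ HL]]; eexists => G Gc Gfree.
  have no F := free_not_embeds (F := F) HL Gfree.
  have deg x := degree_bound x (no _ ltac:(by left)) (no _ ltac:(by right; left)).
  have /card_gt0P[r _] := proj1 Gc; have [d dP] := bfs_depth_exists r Gc.
  have [||P [PC sP]] := isometric_cover_bound (n := n) dP deg;
    [by apply: no; do 2!right; left | by apply: no; do 3!right; left |].
  exact: leq_trans (ispc_le PC) sP.
- move=> [c cP]; exists (s + c.*2 + 4); split; first lia.
  have le4 : family_le HH [:: Kn (s + c.*2 + 4); K1n (s + c.*2 + 4);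
                              F1 (s + c.*2 + 4); F2 (s + c.*2 + 4)].
    by apply: (family_unavoidable HHconn cP HHs) => [G|]; [exact: ispc_le_ispp | lia].
  have le2 : family_le HH [:: F4 (s + c.*2 + 4); F5 (s + c.*2 + 4)].
    by apply: (twin_family_unavoidable HHconn cP HHs) => [G //|]; lia.
  move=> F FL; have [FL4|FL2] := List.in_app_or [:: _; _; _; _] [:: _; _] F FL.
    exact: le4.
  exact: le2.
- move=> [n [_ HL]]; eexists => G Gc Gfree.
  have no F := free_not_embeds (F := F) HL Gfree.
  have deg x := degree_bound x (no _ ltac:(by left)) (no _ ltac:(by right; left)).
  have /card_gt0P[r _] := proj1 Gc; have [d dP] := bfs_depth_exists r Gc.
  have [||||P [PC sP]] := isometric_partition_bound (n := n) dP deg;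
    [by apply: no; do 2!right; left | by apply: no; do 3!right; left |
     by apply: no; do 4!right; left | by apply: no; do 5!right; left |].
  exact: leq_trans (ispp_le PC) sP.
Qed.
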